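(* Let $A$ be a Banach algebra with a right identity $e$, and let $d$ be a Jordan left derivation of $A$. Then $d$ maps $A$ into $eA$.
   Context: Banach algebras are over $\mathbb{C}$ and associative, and are not assumed to be commutative or unital. A right identity of $A$ is an element $e \in A$ with $ae = a$ for all $a \in A$, and $eA = \{ea : a \in A\}$. A linear map $d: A \to A$ (not assumed continuous) is a Jordan left derivation if $d(a^2) = 2a\,d(a)$ for all $a \in A$. *)

(* Defs.v *)
From HB Require Import structures.
From mathcomp Require Import all_boot all_order all_algebra.
From mathcomp Require Import complex.
From mathcomp Require Import all_classical all_reals all_analysis.

Set Implicit Arguments.
Unset Strict Implicit.
Unset Printing Implicit Defensive.

Import Order.TTheory GRing.Theory Num.Theory.
Import numFieldNormedType.Exports.

Local Open Scope classical_set_scope.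
Local Open Scope ring_scope.
Local Open Scope complex_scope.

(* The product is a separate operation rather than a MathComp ring structure
   because those all have a unit. *)
HB.mixin Record isBanachAlgebra (R : realType) A
    & CompleteNormedModule R[i] A := {
  bmul : A -> A -> A ;
  bmulA : associative bmul ;
  bmul_linearl : forall b : A, linear (fun a : A => bmul a b) ;
  bmul_linearr : forall a : A, linear (fun b : A => bmul a b) ;
  (* an inequality in R[i], between nonnegative reals *)
  bmul_norm_le : forall a b : A, `|bmul a b| <= `|a| * `|b|
}.

#[short(type="banachAlgType")]
HB.structure Definition BanachAlgebra (R : realType) :=
  { A of isBanachAlgebra R A & CompleteNormedModule R[i] A }.

Notation "a ** b" := (bmul a b) (at level 40, left associativity) : ring_scope.

Definition right_identity (R : realType) (A : banachAlgType R) (e : A) : Prop :=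
  forall a : A, a ** e = a.

Definition right_ideal_of (R : realType) (A : banachAlgType R) (e : A) : set A :=
  [set e ** a | a in [set: A]].

Definition jordan_left_derivation (R : realType) (A : banachAlgType R)
    (d : {linear A -> A}) : Prop :=
  forall a : A, d (a ** a) = 2%:R *: (a ** d a).

(* Main.v *)
(* Polarising d(a^2) = 2a d(a) at e, where d(e) = 0, gives
   d(a) + d(ea) = 2e d(a).  Applied to ea it gives d(ea) = e d(ea), and then,
   multiplying by e, e d(a) = e d(ea) = d(ea), hence d(a) = e d(a). *)
Require Import Defs.
From HB Require Import structures.
From mathcomp Require Import all_boot all_order all_algebra.
From mathcomp Require Import complex.
From mathcomp Require Import all_classical all_reals all_analysis.
Import GRing.Theory Num.Theory.
Import numFieldNormedType.Exports.
Local Open Scope classical_set_scope.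
Local Open Scope ring_scope.

Section BilinearProduct.
Variables (R : realType) (A : banachAlgType R).
Implicit Types a b c : A.

Lemma bmulDl a b c : (a + b) ** c = a ** c + b ** c.
Proof. by have := bmul_linearl c 1 a b; rewrite !scale1r. Qed.

Lemma bmulDr a b c : a ** (b + c) = a ** b + a ** c.
Proof. by have := bmul_linearr a 1 b c; rewrite !scale1r. Qed.

End BilinearProduct.

(** Scalars have characteristic zero, so [2] is invertible. This cancels the factor [2] that the
    Jordan identity produces. *)
Lemma addrr_inj (K : numFieldType) (V : lmodType K) :
  injective (fun x : V => x + x).
Proof.
have two_neq0 : (2%:R : K) != 0 by rewrite pnatr_eq0.
by move=> x y xy; apply: (scalerI two_neq0); rewrite !scaler_nat !mulr2n.
Qed.

Section JordanLeftDerivation.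
Variables (R : realType) (A : banachAlgType R) (d : {linear A -> A}).
Hypothesis hd : jordan_left_derivation d.

Lemma jordan_left_derivation_sqr (a : A) : d (a ** a) = a ** d a + a ** d a.
Proof. by rewrite hd scaler_nat mulr2n. Qed.

(** Expand the square rule at [a + b] and cancel the square rules at [a] and [b]; noncommutativity
    keeps both mixed products on the left. *)
Lemma jordan_left_derivation_polar (a b : A) :
  d (a ** b) + d (b ** a) = (a ** d b + b ** d a) + (a ** d b + b ** d a).
Proof.
have := jordan_left_derivation_sqr (a + b).
rewrite !(bmulDl, bmulDr, linearD) /= !jordan_left_derivation_sqr.
(* Both sides are regrouped as (square of [a] + mixed terms) + square of [b], so the outer summands
   match syntactically and cancel. *)
rewrite [LHS](AC (2*2) ((1*(2*3))*4)).
rewrite [RHS](AC ((2*2)*(2*2)) (((1*5)*((2*3)*(6*7)))*(4*8))).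
by move/addIr/addrI.
Qed.

Variable e : A.
Hypothesis he : right_identity e.

(** As [e] is idempotent, [d e] is twice [e ** d e]. Left multiplication by [e] makes [e ** d e]
    equal to its own double, so it vanishes, and [d e] with it. *)
Lemma jordan_left_derivation_right_identity : d e = 0.
Proof.
have de := jordan_left_derivation_sqr e; rewrite he in de.
have /eqP := congr1 (bmul e) de.
rewrite bmulDr bmulA he -[X in X == _]addr0 (inj_eq (addrI _)) eq_sym => /eqP ede.
by rewrite de ede addr0.
Qed.

Lemma jordan_left_derivation_mull (a : A) :
  d a + d (e ** a) = e ** d a + e ** d a.
Proof.
have := jordan_left_derivation_polar a e.
have a0 : a ** 0 = 0 by apply: (addrI (a ** 0)); rewrite -bmulDr !addr0.
by rewrite he jordan_left_derivation_right_identity a0 !add0r.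
Qed.

Lemma jordan_left_derivation_fixed (a : A) : e ** d a = d a.
Proof.
have eey : e ** d (e ** a) = d (e ** a).
  have := jordan_left_derivation_mull (e ** a).
  (* Idempotence gives [e ** (e ** a) = e ** a], so both summands on the left coincide. *)
  by rewrite bmulA he => /addrr_inj.
have xy := jordan_left_derivation_mull a.
have := congr1 (bmul e) xy.
rewrite !bmulDr eey !bmulA he => /addrI yex.
(* With [e ** d a] added to each side, the goal is [xy] after [d (e ** a)] is replaced by
   [e ** d a]. *)
by apply: (addIr (e ** d a)); rewrite -xy yex.
Qed.

End JordanLeftDerivation.

Theorem theorem3p1 (R : realType) (A : banachAlgType R) (e : A)
    (he : right_identity e) (d : {linear A -> A})
    (hd : jordan_left_derivation d) :
  d @` [set: A] `<=` right_ideal_of e.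
Proof.
by move=> _ [a _ <-]; exists (d a); last exact: jordan_left_derivation_fixed.
Qed.
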